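(* Let $G$ be a finite simple connected graph with $n(G)$ vertices. Then the diameter of its spanning tree auxiliary graph satisfies \[ diam(Aux(G))\le n(G)-1. \]
   Context: For a finite simple connected graph $G$ on $n$ vertices, the spanning tree auxiliary graph $Aux(G)$ is the graph whose vertices are the spanning trees of $G$, two spanning trees being adjacent if and only if one is obtained from the other by a single unit transformation, i.e. by adding one edge of $G$ not in the tree and deleting a different edge so that the result is again a spanning tree; equivalently, the symmetric difference of their edge sets has exactly two edges (they share exactly $n-2$ of their $n-1$ edges). *)

(* Defs.v *)
From mathcomp Require Import all_boot.
Set Implicit Arguments.
Unset Strict Implicit.
Unset Printing Implicit Defensive.

Record sgraph := SGraph {
  vertex :> finType;
  adj : rel vertex;
  adj_sym : symmetric adj;
  adj_irr : irreflexive adj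
}.

(* Connected graphs are nonempty. *)
Definition connected (G : sgraph) : bool :=
  (0 < #|vertex G|) && [forall x : G, forall y : G, connect (@adj G) x y].

(* A cycle of a simple graph has at least three vertices, all distinct; this
   is why bounding its length by the number of vertices loses nothing. *)
Definition acyclic (G : sgraph) : bool :=
  [forall k : 'I_(#|vertex G|).+1, forall p : k.-tuple G,
     (2 < k) ==> ~~ ucycleb (@adj G) p].

Definition is_tree (G : sgraph) : bool := connected G && acyclic G.

Definition walk (G : sgraph) (k : nat) (x y : G) : bool :=
  [exists p : k.-tuple G, path (@adj G) x p && (last x p == y)].

(* The least length of a walk from x to y. A shortest walk has distinct
   vertices, hence length less than #|vertex G|; when y cannot be reached from
   x the value is #|vertex G|, which diam below never uses. *)
Definition dist (G : sgraph) (x y : G) : nat :=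
  find (fun k => walk k x y) (iota 0 #|vertex G|).

(* None stands for the infinite diameter of a graph that is not connected. *)
Definition diam (G : sgraph) : option nat :=
  if connected G then Some (\max_(x : G) \max_(y : G) dist x y) else None.

Section SpanningTrees.
Variable G : sgraph.

Definition edges : {set {set G}} :=
  [set [set z.1; z.2] | z : G * G & adj z.1 z.2].

Definition span_adj (S : {set {set G}}) : rel G :=
  fun x y => (x != y) && ([set x; y] \in S).

Lemma span_adj_sym S : symmetric (span_adj S).
Proof. by move=> x y; rewrite /span_adj eq_sym setUC. Qed.

Lemma span_adj_irr S : irreflexive (span_adj S).
Proof. by move=> x; rewrite /span_adj eqxx. Qed.

(* The graph with all the vertices of G and edge set S. *)
Definition span_graph (S : {set {set G}}) : sgraph :=
  SGraph (span_adj_sym S) (span_adj_irr S).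

Definition is_spanning_tree (S : {set {set G}}) : bool :=
  (S \subset edges) && is_tree (span_graph S).

Definition spanning_tree : finType :=
  {S : {set {set G}} | is_spanning_tree S}.

Definition aux_adj : rel spanning_tree := fun S T =>
  [exists f in edges :\: val S, exists g in val S,
     val T == (f |: val S) :\ g].

Lemma aux_adj_sym : symmetric aux_adj.
Proof.
suff sub S T : aux_adj S T -> aux_adj T S by move=> S T; apply/idP/idP; apply: sub.
case/exists_inP=> f /setDP[fE fS] /exists_inP[g gS /eqP defT].
have /andP[/subsetP SE _] := valP S.
have neq : f != g by apply: contraNneq fS => ->.
apply/exists_inP; exists g; first by rewrite defT !inE eqxx SE.
apply/exists_inP; exists f; first by rewrite defT !inE eqxx neq.
apply/eqP/setP=> h; rewrite defT !inE.
have [->|hf] := eqVneq h f; first by apply: negbTE.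
by have [->|] := eqVneq h g.
Qed.

Lemma aux_adj_irr : irreflexive aux_adj.
Proof.
move=> S; apply/exists_inP=> -[f _ /exists_inP[g gS /eqP defS]].
by move: gS; rewrite defS !inE eqxx.
Qed.

Definition Aux : sgraph := SGraph aux_adj_sym aux_adj_irr.

End SpanningTrees.

(* Main.v *)
Require Import Defs.
From mathcomp Require Import all_boot.

(** Call a set of edges spanning when it connects every two vertices.  The
    spanning trees of a graph are exactly its minimal spanning sets of edges
    ([spanning_treeP]): an edge can be dropped without disconnecting anything
    precisely when it lies on a cycle.  Everything below is phrased in terms of
    minimality, so cycles occur only in the proof of that equivalence.

    The heart of the argument is the replacement lemma [spans_swap]: if adding
    the edge xy to a set B makes it spanning, then B has at most two components,
    those of x and of y, and so adding any pair uv whose ends are not connected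
    in B makes it spanning too.  It yields the exchange property of trees
    ([exchange]): for distinct spanning trees S and T, take g in S but not in T;
    the set S - g has two components, and the connected set T has an edge f
    between them; replacing g by f in S gives a spanning set by the replacement
    lemma.  The new set is also minimal: if an edge h other than f were
    superfluous in it, replacing f by g back again would make h superfluous
    in S.

    The exchanged tree has one more edge in common with T than S has, so S and T
    are joined by a walk with as many steps as there are edges in T outside S
    ([exchange_walk]).  On n > 0 vertices, a spanning set always contains one of
    at most n - 1 edges, grown one vertex at a time ([spans_small]); by minimality a
    spanning tree has at most n - 1 edges, whence the bound. *)

(** * Connecting vertices by a set of edges *)

Definition spans {G : sgraph} (S : {set {set G}}) : bool :=
  [forall x : G, forall y : G, connect (span_adj S) x y].

Lemma spansP {G : sgraph} {S : {set {set G}}} :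
  reflect (forall x y, connect (span_adj S) x y) (spans S).
Proof. exact: 'forall_forallP. Qed.

Lemma span_connectC {G : sgraph} (S : {set {set G}}) :
  connect_sym (span_adj S).
Proof. by apply: sym_connect_sym; apply: span_adj_sym. Qed.

Lemma span_connectS {G : sgraph} (S T : {set {set G}}) :
  S \subset T -> subrel (connect (span_adj S)) (connect (span_adj T)).
Proof.
move=> /subsetP sST; apply: connect_sub => x y /andP[xy /sST xyT].
by apply: connect1; rewrite /span_adj xy.
Qed.

Lemma spansS {G : sgraph} (S T : {set {set G}}) :
  S \subset T -> spans S -> spans T.
Proof.
by move=> sST /spansP spS; apply/spansP=> x y; apply: (span_connectS _ _ sST).
Qed.

Lemma spans_from {G : sgraph} (S : {set {set G}}) (r : G) :
  (forall x, connect (span_adj S) r x) -> spans S.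
Proof.
move=> rS; apply/spansP=> x y; apply: connect_trans (rS y).
by rewrite span_connectC.
Qed.

Lemma connect_edge {G : sgraph} (S : {set {set G}}) (x y : G) :
  [set x; y] \in S -> connect (span_adj S) x y.
Proof.
have [-> _|xy xyS] := eqVneq x y; first exact: connect0.
by apply: connect1; rewrite /span_adj xy.
Qed.

(** Otherwise [A] would be a union of components. *)
Lemma crossing_edge {G : sgraph} (S : {set {set G}}) (A : {set G}) (r z : G) :
  spans S -> r \in A -> z \notin A ->
  exists a b, [/\ a \in A, b \notin A & [set a; b] \in S].
Proof.
move=> /spansP spS rA zA.
case: (boolP [exists a in A, exists b in ~: A, [set a; b] \in S]).
  move=> /exists_inP[a aA /exists_inP[b]]; rewrite inE => bA abS.
  by exists a, b.
move=> /exists_inPn noS; case/negP: zA.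
suff clA : closed (span_adj S) (mem A) by rewrite -(closed_connect clA (spS r z)).
apply: intro_closed; first exact: span_connectC.
move=> a b /andP[_ abS] aA; apply: contraT => bA.
by have /exists_inPn/(_ b) := noS a aA; rewrite inE abS; apply.
Qed.

Lemma spans_two_components {G : sgraph} (B : {set {set G}}) (x y z : G) :
  spans ([set x; y] |: B) ->
  connect (span_adj B) x z || connect (span_adj B) y z.
Proof.
move=> spB; apply: contraT => Nz.
pose A := [set z | connect (span_adj B) x z || connect (span_adj B) y z].
have xA : x \in A by rewrite inE connect0.
have zA : z \notin A by rewrite inE.
have [a [b [aA bA]]] := crossing_edge _ _ _ _ spB xA zA.
case/setU1P=> [abxy|abB]; case/negP: bA; rewrite inE.
  have : b \in [set x; y] by rewrite -abxy set22.
  by move=> /set2P[]->; rewrite connect0 ?orbT.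
move: aA; rewrite inE => /orP[] aA; apply/orP; [left|right];
  by apply: connect_trans aA _; apply: connect_edge.
Qed.

(** One of [u], [v] lies in the component of [x] in [B] and the other in that of
    [y], so the pair [uv] joins the same two components as [xy]. *)
Lemma spans_swap {G : sgraph} (B : {set {set G}}) (x y u v : G) :
  spans ([set x; y] |: B) -> ~~ connect (span_adj B) u v ->
  spans ([set u; v] |: B).
Proof.
wlog xu : x y / connect (span_adj B) x u.
  move=> wl spB; have /orP[xu|yu] := spans_two_components _ _ _ u spB.
    exact: wl xu spB.
  by rewrite [[set x; y]]setUC in spB; apply: wl yu spB.
move=> spB Nuv.
have yv : connect (span_adj B) y v.
  have /orP[xv|//] := spans_two_components _ _ _ v spB.
  by case/negP: Nuv; apply: connect_trans xv; rewrite span_connectC.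
have up := span_connectS _ _ (subsetU1 [set u; v] B).
apply: (spans_from _ u) => z.
have /orP[xz|yz] := spans_two_components _ _ _ z spB.
  by apply: up; apply: connect_trans xz; rewrite span_connectC.
apply: (connect_trans (y := v)); first by apply: connect_edge; apply: setU11.
by apply: up; apply: connect_trans yz; rewrite span_connectC.
Qed.

(** The subset is grown together with the set [A] of vertices that it reaches
    from [r]: each new vertex costs one crossing edge. *)
Lemma spans_small {G : sgraph} (S : {set {set G}}) (r : G) :
  spans S -> exists2 P : {set {set G}}, P \subset S & spans P /\ #|P| < #|G|.
Proof.
move=> spS.
have grow k : k < #|G| -> exists A : {set G}, exists P : {set {set G}},
    [/\ r \in A, #|A| = k.+1, P \subset S, #|P| <= k
      & forall z, z \in A -> connect (span_adj P) r z].
  elim: k => [_|k IHk ltkn].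
    exists [set r], set0; rewrite set11 cards1 cards0 sub0set; split=> // z.
    by move=> /set1P->.
  have [A [P [rA cA sPS cP conA]]] := IHk (ltnW ltkn).
  have /subsetPn[z _ zA] : ~~ ([set: G] \subset A).
    by apply/negP=> /subset_leq_card; rewrite cardsT cA leqNgt ltkn.
  have [a [b [aA bA abS]]] := crossing_edge _ _ _ _ spS rA zA.
  have up := span_connectS _ _ (subsetU1 [set a; b] P).
  exists (b |: A), ([set a; b] |: P); split.
  - by rewrite inE rA orbT.
  - by rewrite cardsU1 bA cA.
  - by rewrite subUset sub1set abS.
  - by rewrite cardsU1 -add1n leq_add ?leq_b1.
  move=> w /setU1P[->|/conA/up//].
  apply: connect_trans (up _ _ (conA a aA)) _.
  by apply: connect_edge; apply: setU11.
have n_gt0 : 0 < #|G| by apply/card_gt0P; exists r.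
have [|A [P [rA cA sPS cP conA]]] := grow #|G|.-1; first by rewrite prednK.
exists P => //; split; last by rewrite -(prednK n_gt0) ltnS.
apply: (spans_from _ r) => z; apply: conA.
suff -> : A = setT by rewrite inE.
by apply/eqP; rewrite eqEcard subsetT cardsT cA prednK /=.
Qed.

(** * Spanning trees as minimal spanning sets *)

(** Going around the cycle the other way avoids the edge between its first two
    vertices, since neither of them is met again before the end. *)
Lemma cycle_detour {G : sgraph} (S : {set {set G}}) (x y : G) (p : seq G) :
  p != [::] -> ucycle (span_adj S) [:: x, y & p] ->
  connect (span_adj (S :\ [set x; y])) y x.
Proof.
case: p => [//|z p] _ /andP[/= /and3P[_ yzS pS]].
rewrite !inE !negb_or -!andbA => /and5P[xy xz xp yz /and3P[yp _ _]].
have off a b : b != y -> a != y -> span_adj S a b ->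
    span_adj (S :\ [set x; y]) a b.
  move=> bNy aNy /andP[ab abS]; rewrite /span_adj ab in_setD1 abS andbT /=.
  apply/eqP=> /setP/(_ y).
  by rewrite !inE eqxx orbT eq_sym (negbTE aNy) eq_sym (negbTE bNy).
apply: (connect_trans (y := z)).
  apply: connect1; move: yzS => /andP[_ yzS].
  rewrite /span_adj yz in_setD1 yzS andbT; apply/eqP=> /setP/(_ x).
  by rewrite !inE eqxx (negbTE xy) (negbTE xz).
apply/connectP; exists (rcons p x); last by rewrite last_rcons.
have : y \notin z :: rcons p x.
  by rewrite inE mem_rcons inE !negb_or yz eq_sym xy.
elim: (rcons p x) z pS {xz yz yzS} => //= b q IHq a /andP[abS bqS].
rewrite !inE !negb_or => /and3P[ya yb yq].
rewrite off 1?eq_sym //=; apply: IHq => //; by rewrite inE negb_or yb.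
Qed.

(** A path around the edge, once shortened, closes up to a cycle with it. *)
Lemma acyclic_bridge {G : sgraph} (S : {set {set G}}) (x y : G) :
  acyclic (span_graph S) -> x != y -> [set x; y] \in S ->
  ~~ connect (span_adj (S :\ [set x; y])) x y.
Proof.
move=> /forallP acS xy xyS; apply/negP=> /connectP[p0 pathp0 defy].
have {p0 pathp0 defy} [p [pathp Up defy]] : exists p,
    [/\ path (span_adj (S :\ [set x; y])) x p, uniq (x :: p) & y = last x p].
  by case/shortenP: pathp0 defy => p *; exists p.
have size_p : 1 < size p.
  case: p pathp defy {Up} => [|z [|//]] /= pathp defy.
    by rewrite defy eqxx in xy.
  by move: pathp; rewrite -defy /span_adj !inE eqxx /= andbF.
have sizeP : size (x :: p) < #|G|.+1.
  by rewrite ltnS -(card_uniqP Up) max_card.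
have /forallP/(_ (in_tuple (x :: p)))/implyP/(_ size_p) := acS (Ordinal sizeP).
case/negP; rewrite /ucycleb Up andbT /= rcons_path -defy.
rewrite {2}/span_adj [y == x]eq_sym xy setUC xyS !andbT.
by apply: sub_path pathp => a b /andP[ab /setD1P[_ abS]]; rewrite /span_adj ab.
Qed.

Lemma edges_ends {G : sgraph} (S : {set {set G}}) (h : {set G}) :
  S \subset edges G -> h \in S -> exists x y : G, x != y /\ h = [set x; y].
Proof.
move=> /subsetP SE /SE /imsetP[[x y]]; rewrite inE /= => xyG ->.
by exists x, y; split=> //; apply: contraTneq xyG => ->; rewrite adj_irr.
Qed.

Lemma spanning_treeP {G : sgraph} {S : {set {set G}}} : 0 < #|G| ->
  reflect [/\ S \subset edges G, spans S
            & forall h, h \in S -> ~~ spans (S :\ h)]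
          (is_spanning_tree S).
Proof.
move=> n_gt0; rewrite /is_spanning_tree /is_tree /connected n_gt0 /=.
apply: (iffP and3P) => [[SE spS acS]|[SE spS minS]]; split=> //.
  move=> h hS; have [x [y [xy defh]]] := edges_ends _ _ SE hS.
  have := @acyclic_bridge G S x y acS xy; rewrite -defh => /(_ hS).
  by apply: contra => /spansP.
apply/forallP=> k; apply/forallP=> -[[|x [|y p]] /= /eqP <-] //.
apply/implyP=> p_gt0; apply/negP=> cyc.
have xyS : [set x; y] \in S by case/andP: cyc => /= /andP[/andP[]].
have yx : connect (span_adj (S :\ [set x; y])) y x.
  by apply: cycle_detour cyc; case: (p) p_gt0.
case/negP: (minS _ xyS); apply/spansP=> a b.
apply: connect_sub (spansP spS a b) => {}a {}b /andP[ab abS].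
have [abxy|abNxy] := eqVneq [set a; b] [set x; y]; last first.
  by apply: connect1; rewrite /span_adj ab !inE abNxy.
have : a \in [set x; y] by rewrite -abxy set21.
have : b \in [set x; y] by rewrite -abxy set22.
by move=> /set2P[]-> /set2P[]->; rewrite ?connect0 // span_connectC.
Qed.

Lemma spanning_tree_exists {G : sgraph} :
  connected G -> exists S : {set {set G}}, is_spanning_tree S.
Proof.
case/andP=> n_gt0 /'forall_forallP conG.
have spE : spans (edges G).
  apply/spansP=> x y; apply: connect_sub (conG x y) => {}x {}y xy.
  by apply: connect_edge; apply/imsetP; exists (x, y); rewrite ?inE.
have [S /minsetP[spS minS] SE] := minset_exists spE.
exists S; apply/(spanning_treeP n_gt0); split=> // h hS.
apply/negP=> /minS/(_ (subD1set _ _)) eqS.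
by move: hS; rewrite -eqS !inE eqxx.
Qed.

Lemma card_spanning_tree {G : sgraph} (S : {set {set G}}) :
  is_spanning_tree S -> #|S| < #|G|.
Proof.
move=> trS; have n_gt0 : 0 < #|G| by case/and3P: trS => _ /andP[].
have [_ spS minS] := spanning_treeP n_gt0 trS.
have /card_gt0P[r _] := n_gt0.
have [P sPS [spP]] := spans_small _ r spS.
apply: leq_ltn_trans; apply/subset_leq_card/subsetP=> h hS; apply: contraT => hP.
case/negP: (minS h hS); apply: spansS spP.
by rewrite subsetD1 sPS.
Qed.

(** * Exchanging edges *)

Lemma exchange {G : sgraph} (S T : spanning_tree G) : S != T ->
  exists f (S' : spanning_tree G),
    [/\ f \in val T :\: val S, aux_adj S S'
      & val T :\: val S' = (val T :\: val S) :\ f].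
Proof.
move=> neST; have n_gt0 : 0 < #|G| by case/and3P: (valP S) => _ /andP[].
have [SE spS minS] := spanning_treeP n_gt0 (valP S).
have [TE spT minT] := spanning_treeP n_gt0 (valP T).
have [g gS gT] : exists2 g, g \in val S & g \notin val T.
  apply/subsetPn; apply: contra neST => sST.
  rewrite -val_eqE eqEsubset sST; apply/subsetP=> h hT; apply: contraT => hS.
  by case/negP: (minT h hT); apply: spansS spS; rewrite subsetD1 sST.
have [x [y [xy defg]]] := edges_ends _ _ SE gS.
pose B := val S :\ g; have spB : spans ([set x; y] |: B) by rewrite -defg setD1K.
pose A := [set z | connect (span_adj B) x z].
have xA : x \in A by rewrite inE connect0.
have [z zA] : exists z, z \notin A.
  apply/existsP; rewrite -negb_forall; apply: contra (minS g gS) => /forallP xB.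
  by apply: (spans_from _ x) => z; have := xB z; rewrite inE.
have [u [v [uA vA fT]]] := crossing_edge _ _ _ _ spT xA zA.
set f := [set u; v] in fT.
have Nuv : ~~ connect (span_adj B) u v.
  by rewrite !inE in uA vA; apply: contra vA; apply: connect_trans.
have fg : f != g by apply: contraNneq gT => <-.
have fS : f \notin val S.
  by apply: contra Nuv => fS; apply: connect_edge; rewrite !inE fg.
have defS' : (f |: val S) :\ g = f |: B.
  by apply/setP=> h; rewrite !inE; have [->|//] := eqVneq h f; rewrite fg.
have fB : f \notin B by rewrite inE negb_and fS orbT.
have NB : ~~ connect (span_adj B) x y.
  apply: contra (minS g gS) => xyB; apply: (spans_from _ x) => w.
  have /orP[//|yw] := spans_two_components _ _ _ w spB.
  exact: connect_trans xyB yw.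
have trS' : is_spanning_tree (f |: B).
  apply/(spanning_treeP n_gt0); split.
  - rewrite subUset sub1set (subsetP TE) //=.
    exact: subset_trans (subD1set _ _) SE.
  - exact: spans_swap spB Nuv.
  move=> h /setU1P[->|hB]; first by rewrite setU1K //; apply: minS.
  have [hg hS] := setD1P hB.
  have hf : h != f by apply: contraNneq fB => <-.
  apply: contra (minS h hS) => spS'.
  (* The ends of g are not connected in B, still less in B - h, so g may
     replace f again. *)
  have Nxy : ~~ connect (span_adj (B :\ h)) x y.
    by apply: contra NB; apply: span_connectS; apply: subD1set.
  have -> : val S :\ h = [set x; y] |: (B :\ h).
    rewrite -defg; apply/setP=> e; rewrite !inE.
    by have [->|//] := eqVneq e g; rewrite gS eq_sym hg.
  apply: (spans_swap _ u v) Nxy; apply: spansS spS'.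
  by apply/subsetP=> e; rewrite -/f !inE; case: (e == f); rewrite ?andbT.
exists f, (exist (@is_spanning_tree G) _ trS'); split.
- by rewrite inE fS.
- apply/exists_inP; exists f; first by rewrite inE fS (subsetP TE).
  by apply/exists_inP; exists g; rewrite //= defS'.
apply/setP=> e; rewrite !inE negb_or negb_and negbK -andbA.
by have [->|//] := eqVneq e g; rewrite (negbTE gT) !andbF.
Qed.

Lemma exchange_walk {G : sgraph} (S T : spanning_tree G) :
  walk (G := Aux G) #|val T :\: val S| S T.
Proof.
move Dk: #|_| => k; elim: k S Dk => [|k IHk] S Dk.
all: have [eqST|/exchange[f [S' [fTS adjS defTS]]]] := eqVneq S T.
- by apply/existsP; exists [tuple]; rewrite /= eqST.
- by rewrite (cardsD1 f) fTS in Dk.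
- by rewrite eqST setDv cards0 in Dk.
have /existsP[p /andP[pathp lastp]] : walk (G := Aux G) k S' T.
  by apply: IHk; rewrite defTS; move: Dk; rewrite (cardsD1 f) fTS => -[].
by apply/existsP; exists [tuple of (S' : Aux G) :: p]; rewrite /= adjS pathp.
Qed.

(** * Distances *)

(** Long walks are no exception: [dist] never exceeds the number of vertices,
    the value that [find] returns when it fails. *)
Lemma dist_le_walk {G : sgraph} (k : nat) (x y : G) : walk k x y -> dist x y <= k.
Proof.
move=> walk_k; rewrite leqNgt; apply/negP=> lt_k.
have ltkn : k < #|G|.
  by apply: leq_trans lt_k _; rewrite /dist -[X in _ <= X](size_iota 0) find_size.
by have := before_find 0 lt_k; rewrite nth_iota // walk_k.
Qed.

Lemma walk_connect {G : sgraph} (k : nat) (x y : G) :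
  walk k x y -> connect (@adj G) x y.
Proof.
by case/existsP=> p /andP[pathp /eqP<-]; apply/connectP; exists p.
Qed.

Theorem lemma12 (G : sgraph) (hG : connected G) :
  exists2 d : nat, diam (Aux G) = Some d & d <= #|vertex G| - 1.
Proof.
have conAux : connected (Aux G).
  apply/andP; split.
    have [S trS] := spanning_tree_exists hG.
    by apply/card_gt0P; exists (exist (@is_spanning_tree G) S trS : Aux G).
  apply/'forall_forallP=> S T.
  exact: (walk_connect (G := Aux G)) (exchange_walk S T).
rewrite /diam conAux; eexists; first by [].
apply/bigmax_leqP=> S _; apply/bigmax_leqP=> T _.
apply: leq_trans (dist_le_walk (G := Aux G) _ _ _ (exchange_walk S T)) _.
apply: leq_trans (subset_leq_card (subsetDl _ _)) _.
have ltTn := card_spanning_tree _ (valP T).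
by rewrite subn1 -ltnS (ltn_predK ltTn).
Qed.
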